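(* Let $K\ge2$ and $\beta\in(0,1)$. The Singleton Search Engine Game with $K$ engines, parameter $\beta$ and the proportional selection rule has at most one symmetric (pure Nash) equilibrium. Moreover, whenever $\beta>1-1/K$, a symmetric (pure Nash) equilibrium exists.
   Context: Proportional selection rule: $f_i(\mathbf q)=\frac{q_i}{\sum_j q_j}$ for $\mathbf q\in[0,1]^K\setminus\{\mathbf 0\}$, and $f_i(\mathbf 0)=1/K$. Singleton Search Engine Game: there are $K$ engines, $N$ pages $\{1,\dots,N\}$, and a probability distribution $\gamma$ on pages with $\gamma(n)>0$ for all $n$; a user of type $n$ (probability $\gamma(n)$) desires exactly page $n$ and looks only at the first displayed page. A pure strategy of engine $i$ is a probability vector $\mathbf q_i=(q_i(n))_{n=1}^N$, where $q_i(n)$ is the probability of displaying page $n$. With $\mathbf q(n)=(q_1(n),\dots,q_K(n))$ and parameter $\beta\in[0,1]$, engine $i$'s payoff is $\sum_n\gamma(n)f_i(\mathbf q(n))(\beta+(1-\beta)q_i(n))$, where $f_i(\mathbf q(n))$ is the probability that a user of type $n$ selects engine $i$. A pure Nash equilibrium is a profile of pure strategies from which no engine can strictly improve her payoff by a unilateral deviation to another pure strategy; it is symmetric if all engines play the same probability vector. *)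

(* Defs.v *)
From HB Require Import structures.
From mathcomp Require Import all_boot all_order all_algebra.
From mathcomp Require Import reals.

Set Implicit Arguments.
Unset Strict Implicit.
Unset Printing Implicit Defensive.

Import Order.TTheory GRing.Theory Num.Theory.
Local Open Scope ring_scope.

Definition prob_vector (R : realType) (N : nat) (p : {ffun 'I_N -> R}) : Prop :=
  (forall n, 0 <= p n) /\ \sum_n p n = 1.

Definition proportional (R : realType) (K : nat) (q : {ffun 'I_K -> R})
    (i : 'I_K) : R :=
  if q == [ffun=> 0] then K%:R^-1 else q i / \sum_j q j.

(* s i n is the probability that engine i displays page n; f q i is the
   probability that the user selects engine i when the engines satisfy her
   with probabilities q. *)
Definition payoff (R : realType) (K N : nat)
    (f : {ffun 'I_K -> R} -> 'I_K -> R) (gamma : {ffun 'I_N -> R}) (beta : R)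
    (s : {ffun 'I_K -> {ffun 'I_N -> R}}) (i : 'I_K) : R :=
  \sum_n gamma n * f [ffun j => s j n] i * (beta + (1 - beta) * s i n).

Definition deviate (R : realType) (K N : nat)
    (s : {ffun 'I_K -> {ffun 'I_N -> R}}) (i : 'I_K) (t : {ffun 'I_N -> R}) :
    {ffun 'I_K -> {ffun 'I_N -> R}} :=
  [ffun j => if j == i then t else s j].

Definition nash_equilibrium (R : realType) (K N : nat)
    (f : {ffun 'I_K -> R} -> 'I_K -> R) (gamma : {ffun 'I_N -> R}) (beta : R)
    (s : {ffun 'I_K -> {ffun 'I_N -> R}}) : Prop :=
  (forall i, prob_vector (s i)) /\
  (forall i (t : {ffun 'I_N -> R}), prob_vector t ->
     payoff f gamma beta (deviate s i t) i <= payoff f gamma beta s i).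

Definition symmetric_profile (R : realType) (K N : nat)
    (s : {ffun 'I_K -> {ffun 'I_N -> R}}) : Prop :=
  forall i j, s i = s j.

Definition symmetric_equilibrium (R : realType) (K N : nat)
    (f : {ffun 'I_K -> R} -> 'I_K -> R) (gamma : {ffun 'I_N -> R}) (beta : R)
    (s : {ffun 'I_K -> {ffun 'I_N -> R}}) : Prop :=
  nash_equilibrium f gamma beta s /\ symmetric_profile s.

(* Main.v *)
(** Against opponents who all play [p], the payoff is separable over pages.  An
equilibrium [p] has full support, because a page that nobody displays is won
outright with an arbitrarily small probability.  The first-order conditions then
equalise the marginal payoffs [gamma n * (A / p n + B)], with [A, B > 0]; writing
[lambda] for the common value, [p n = A * gamma n / (lambda - B * gamma n)] is
decreasing in [lambda], so that [\sum_n p n = 1] determines [lambda].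
Conversely the intermediate value theorem provides such a [lambda], and when
[beta > 1 - 1/K] the payoff of a page is concave in the deviation, so that the
first-order conditions suffice. *)
Require Import Defs.
From mathcomp Require Import all_boot all_order all_algebra.
From mathcomp Require Import reals.
From mathcomp Require Import classical_sets topology normedtype.
From mathcomp Require Import ring lra.
Import Order.TTheory GRing.Theory Num.Theory.
Import numFieldNormedType.Exports.
Local Open Scope ring_scope.

(** * Reduction to a best-reply problem separable over pages *)

(* Payoff from a user displayed her page with probability [t], when each of the
   [K - 1] opponents displays it with probability [x]. *)
Definition page_payoff {R : realType} (K : nat) (beta x t : R) : R :=
  (if (t == 0) && (x == 0) then K%:R^-1 else t / (t + (K%:R - 1) * x)) *
  (beta + (1 - beta) * t).

(** The derivative of [page_payoff K beta x] at [t = x], for [x > 0]. *)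
Definition marginal_payoff {R : realType} (K : nat) (beta x : R) : R :=
  (beta * (K%:R - 1) / x + (1 - beta) * (2 * K%:R - 1)) / K%:R ^+ 2.

Definition symmetric_payoff {R : realType} (K : nat) {N : nat} (gamma : {ffun 'I_N -> R})
    (beta : R) (p t : {ffun 'I_N -> R}) : R :=
  \sum_n gamma n * page_payoff K beta (p n) (t n).

Definition symmetric_best_reply {R : realType} (K : nat) {N : nat}
    (gamma : {ffun 'I_N -> R}) (beta : R) (p : {ffun 'I_N -> R}) : Prop :=
  prob_vector p /\
  (forall t, prob_vector t ->
     symmetric_payoff K gamma beta p t <= symmetric_payoff K gamma beta p p).

Lemma payoff_deviate {R : realType} (K N : nat) (gamma : {ffun 'I_N -> R})
    (beta : R) (p t : {ffun 'I_N -> R}) (i : 'I_K) :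
  (2 <= K)%N ->
  payoff (@proportional R K) gamma beta (deviate [ffun=> p] i t) i =
  symmetric_payoff K gamma beta p t.
Proof.
move=> hK; apply: eq_bigr => n _; rewrite -mulrA; congr (_ * _).
rewrite /page_payoff /proportional !ffunE eqxx; congr (_ * _).
have -> : ([ffun j => deviate [ffun=> p] i t j n] == [ffun=> 0]) =
          (t n == 0) && (p n == 0).
  apply/eqP/andP => [/ffunP h | [/eqP t0 /eqP p0]].
    split; first by move: (h i); rewrite !ffunE eqxx => ->.
    (* As [K >= 2], engine [i] has an opponent [j], whose entry gives [p n = 0]. *)
    have /card_gt0P[j] : (0 < #|predC1 i|)%N by rewrite cardC1 card_ord -subn1 subn_gt0.
    rewrite !inE => ji.
    by move: (h j); rewrite !ffunE (negbTE ji) => ->.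
  by apply/ffunP => j; rewrite !ffunE; case: ifP; rewrite ?ffunE.
case: ifP => // _; congr (_ / _).
rewrite (bigD1 i) //= !ffunE eqxx; congr (_ + _).
rewrite (eq_bigr (fun=> p n)) => [|j /negbTE ji]; last by rewrite !ffunE ji.
rewrite sumr_const cardC1 card_ord -subn1 mulrnBr ?mulr1n; last exact: ltnW.
by rewrite mulrBl mul1r mulr_natl.
Qed.

(** Against a constant profile every engine faces the same problem, so one optimality condition
    covers all deviators. *)
Lemma symmetric_equilibriumE {R : realType} (K N : nat) (gamma : {ffun 'I_N -> R})
    (beta : R) (p : {ffun 'I_N -> R}) :
  (2 <= K)%N ->
  symmetric_equilibrium (@proportional R K) gamma beta [ffun=> p] <->
  symmetric_best_reply K gamma beta p.
Proof.
move=> hK.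
have dev0 (i : 'I_K) : deviate [ffun=> p] i p = [ffun=> p].
  by apply/ffunP => j; rewrite !ffunE if_same.
have payE (i : 'I_K) := payoff_deviate K N gamma beta p p i hK.
split=> [[[prob_s nash] _] | [prob_p best]].
  have i : 'I_K := Ordinal (ltnW hK).
  split=> [|t /(nash i)]; first by have := prob_s i; rewrite ffunE.
  by rewrite payoff_deviate // -(payE i) dev0.
split; last by move=> i j; rewrite !ffunE.
split=> [i | i t /best]; first by rewrite ffunE.
by rewrite payoff_deviate // -(payE i) dev0.
Qed.

(** * Second-order expansion of the payoff of a page *)

(** The remainder is exact: its size gives the local bound behind the necessary conditions, its sign
    the global tangent bound behind existence. *)
Lemma page_payoff_expansion {R : realType} (K : nat) (beta x t : R) :
  (2 <= K)%N -> 0 < x -> 0 <= t ->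
  page_payoff K beta x t = page_payoff K beta x x
    + marginal_payoff K beta x * (t - x)
    - (K%:R - 1) * (beta - (1 - beta) * ((K%:R - 1) * x)) / (K%:R ^+ 2 * x)
      * (t - x) ^+ 2 / (t + (K%:R - 1) * x).
Proof.
move=> hK x0 t0; have k2 : 2 <= K%:R :> R by rewrite ler_nat.
rewrite /page_payoff /marginal_payoff (gt_eqF x0) !andbF.
have tx : 0 < t + (K%:R - 1) * x by rewrite ltr_wpDl// mulr_gt0//; lra.
have xx : 0 < x + (K%:R - 1) * x by rewrite addr_gt0// mulr_gt0//; lra.
by field; rewrite !gt_eqF //; lra.
Qed.

Lemma le0_of_le_mul_small {R : realFieldType} (a C d : R) :
  0 < d -> (forall e, 0 < e -> e <= d -> a <= C * e) -> a <= 0.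
Proof.
move=> d0 small; rewrite leNgt; apply/negP => a0.
have c0 : 0 < `|C| + 1 by rewrite ltr_wpDl.
(* So small that [C * e <= a / 2 < a]. *)
pose e := Num.min d (a / (`|C| + 1) / 2).
have e0 : 0 < e by rewrite lt_min d0 /= !divr_gt0.
have ed : e <= d by rewrite ge_min lexx.
have := small e e0 ed.
have : e * (`|C| + 1) <= a / 2.
  by rewrite -ler_pdivlMr // mulrAC ge_min lexx orbT.
have := ler_norm C.
by nra.
Qed.

Lemma page_payoff_ge {R : realType} (K : nat) (beta x : R) :
  (2 <= K)%N -> 0 < x ->
  exists2 C, 0 <= C & forall e, `|e| <= x ->
    marginal_payoff K beta x * e - C * e ^+ 2 <=
    page_payoff K beta x (x + e) - page_payoff K beta x x.
Proof.
move=> hK x0; have k2 : 2 <= K%:R :> R by rewrite ler_nat.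
set D := (K%:R - 1) * (beta - (1 - beta) * ((K%:R - 1) * x)) / (K%:R ^+ 2 * x).
have hx : 0 < (K%:R - 1) * x by rewrite mulr_gt0//; lra.
(* For [x + e >= 0] the denominator of the remainder is at least [(K - 1) * x]. *)
exists (`|D| / ((K%:R - 1) * x)) => [|e]; first by rewrite divr_ge0 // ltW.
rewrite ler_norml => /andP[xe _].
have xe0 : 0 <= x + e by lra.
have := page_payoff_expansion K beta x (x + e) hK x0 xe0; rewrite -/D [x + e - x]addrAC subrr add0r.
have h : D * e ^+ 2 / (x + e + (K%:R - 1) * x) <= `|D| / ((K%:R - 1) * x) * e ^+ 2.
  apply: (@le_trans _ _ (`|D| * e ^+ 2 / (x + e + (K%:R - 1) * x))).
    apply: ler_wpM2r; first by rewrite invr_ge0 ltW // ltr_wpDl.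
    by apply: ler_wpM2r; [exact: sqr_ge0 | exact: ler_norm].
  rewrite [leRHS]mulrAC; apply: ler_wpM2l; first by rewrite mulr_ge0 ?sqr_ge0.
  by rewrite lef_pV2 ?posrE ?lerDr // ltr_wpDl.
lra.
Qed.

(** * Necessary conditions by transfers between two pages *)

Lemma big_two {R : nmodType} {I : finType} (H : I -> R) (n m : I) :
  n != m -> (forall k, k != n -> k != m -> H k = 0) -> \sum_k H k = H n + H m.
Proof.
move=> nm H0; rewrite (bigD1 n) //= (bigD1 m) 1?eq_sym //=.
by rewrite big1 ?addr0 // => k /andP[? ?]; apply: H0.
Qed.

(** Moving mass [e] from page [m] to page [n] changes two summands only, and cannot pay. *)
Lemma best_reply_transfer {R : realType} (K N : nat) (gamma : {ffun 'I_N -> R})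
    (beta : R) (p : {ffun 'I_N -> R}) (n m : 'I_N) (e : R) :
  symmetric_best_reply K gamma beta p -> n != m -> 0 <= e -> e <= p m ->
  gamma n * (page_payoff K beta (p n) (p n + e) - page_payoff K beta (p n) (p n))
  <= gamma m * (page_payoff K beta (p m) (p m)
                - page_payoff K beta (p m) (p m - e)).
Proof.
move=> [[p0 p1] best] nm e0 em.
pose t : {ffun 'I_N -> R} :=
  [ffun k => if k == n then p n + e else if k == m then p m - e else p k].
have tn : t n = p n + e by rewrite ffunE eqxx.
have tm : t m = p m - e by rewrite ffunE eqxx eq_sym (negbTE nm).
have tk k : k != n -> k != m -> t k = p k.
  by move=> /negbTE kn /negbTE km; rewrite ffunE kn km.
have prob_t : prob_vector t.
  split=> [k|].
    by rewrite ffunE; case: ifP => _; [rewrite addr_ge0|case: ifP; rewrite ?subr_ge0].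
  apply/eqP; rewrite -p1 -subr_eq0 -sumrB (big_two _ _ _ nm) => [|k kn km].
    by rewrite tn tm; apply/eqP; ring.
  by rewrite tk // subrr.
have := best t prob_t; rewrite -subr_le0 -sumrB (big_two _ _ _ nm) => [|k kn km].
  by rewrite tn tm; lra.
by rewrite tk // subrr.
Qed.

Lemma prob_vector_gt0 {R : realType} (N : nat) (p : {ffun 'I_N -> R}) :
  prob_vector p -> exists n, 0 < p n.
Proof.
move=> [p0 p1]; have /psumr_neq0P : \sum_n p n <> 0 by rewrite p1; apply/eqP/oner_neq0.
by move=> /(_ (fun n _ => p0 n)) [n /andP[_ pn]]; exists n.
Qed.

(** On a page that nobody displays, any [e > 0] lifts the winning probability from [1/K] to [1],
    while taking [e] from a displayed page costs only [O(e)]. *)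
Lemma best_reply_gt0 {R : realType} (K N : nat) (gamma : {ffun 'I_N -> R})
    (beta : R) (p : {ffun 'I_N -> R}) :
  (2 <= K)%N -> (forall n, 0 < gamma n) -> 0 < beta -> beta < 1 ->
  symmetric_best_reply K gamma beta p -> forall n, 0 < p n.
Proof.
move=> hK gamma0 b0 b1 eq_p n; have [prob_p _] := eq_p.
rewrite lt_neqAle prob_p.1 andbT eq_sym; apply/eqP => pn.
have [m pm] := prob_vector_gt0 _ _ prob_p.
have nm : n != m by apply: contraTneq pm => <-; rewrite pn ltxx.
have k2 : 2 <= K%:R :> R by rewrite ler_nat.
have [C C0 loss] := page_payoff_ge K beta (p m) hK pm.
have kV : K%:R^-1 < 1 :> R by rewrite invf_lt1; lra.
(* The jump of the payoff from page [n] at zero; it is bounded by a multiple of [e] for all small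
   [e]. *)
suff : gamma n * beta * (1 - K%:R^-1) <= 0.
  by rewrite leNgt !mulr_gt0 // subr_gt0.
apply: (le0_of_le_mul_small _
  (gamma m * (marginal_payoff K beta (p m) + C * p m)) (p m) pm) => e e0 em.
have := best_reply_transfer K N gamma beta p n m e eq_p nm (ltW e0) em.
have -> : page_payoff K beta (p n) (p n + e) = beta + (1 - beta) * e.
  by rewrite /page_payoff pn add0r gt_eqF //= mulr0 addr0 divff ?mul1r ?gt_eqF.
have -> : page_payoff K beta (p n) (p n) = beta * K%:R^-1.
  by rewrite /page_payoff pn eqxx /= mulr0 addr0 mulrC.
have /loss : `|- e| <= p m by rewrite normrN gtr0_norm.
rewrite sqrrN mulrN => {}loss.
have gn0 := gamma0 n; have gm0 := gamma0 m.
have : C * e ^+ 2 <= C * p m * e by rewrite expr2 mulrA ler_pM2r // ler_wpM2l.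
move=> Ce gain.
have : gamma m * (page_payoff K beta (p m) (p m) - page_payoff K beta (p m) (p m - e))
   <= gamma m * ((marginal_payoff K beta (p m) + C * p m) * e).
  by rewrite ler_pM2l //; lra.
have : 0 <= gamma n * ((1 - beta) * e) by rewrite !mulr_ge0 ?subr_ge0 // ltW.
lra.
Qed.

(** The second-order terms of a transfer of [e] vanish after division by [e] as [e] tends to zero.
    Exchanging [n] and [m] gives equality. *)
Lemma best_reply_first_order {R : realType} (K N : nat) (gamma : {ffun 'I_N -> R})
    (beta : R) (p : {ffun 'I_N -> R}) (n m : 'I_N) :
  (2 <= K)%N -> (forall n, 0 < gamma n) -> 0 < beta -> beta < 1 ->
  symmetric_best_reply K gamma beta p ->
  gamma n * marginal_payoff K beta (p n) <= gamma m * marginal_payoff K beta (p m).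
Proof.
move=> hK gamma0 b0 b1 eq_p.
have [->|nm] := eqVneq n m; first exact: lexx.
have p0 := best_reply_gt0 K N gamma beta p hK gamma0 b0 b1 eq_p.
have [Cn _ gain] := page_payoff_ge K beta (p n) hK (p0 n).
have [Cm _ loss] := page_payoff_ge K beta (p m) hK (p0 m).
rewrite -subr_le0; apply: (le0_of_le_mul_small _ (gamma n * Cn + gamma m * Cm)
  (Num.min (p n) (p m))) => [|e e0]; first by rewrite lt_min !p0.
rewrite le_min => /andP[en em].
have transfer := best_reply_transfer K N gamma beta p n m e eq_p nm (ltW e0) em.
have /gain : `|e| <= p n by rewrite gtr0_norm.
rewrite -(ler_pM2l (gamma0 n)) => {}gain.
have /loss : `|- e| <= p m by rewrite normrN gtr0_norm.
rewrite -(ler_pM2l (gamma0 m)) => {}loss.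
rewrite -(ler_pM2r e0); lra.
Qed.

(** * Uniqueness of the symmetric best reply *)

Lemma marginal_payoff_le {R : realType} (K : nat) (beta x y : R) :
  (2 <= K)%N -> 0 < beta -> 0 < x -> 0 < y ->
  marginal_payoff K beta x <= marginal_payoff K beta y -> y <= x.
Proof.
move=> hK b0 x0 y0; have k2 : 2 <= K%:R :> R by rewrite ler_nat.
rewrite /marginal_payoff ler_pM2r ?invr_gt0 ?exprn_gt0 ?lerD2r //; last lra.
by rewrite ler_pM2l ?mulr_gt0 ?lef_pV2 //; lra.
Qed.

Lemma best_reply_unique {R : realType} (K N : nat) (gamma : {ffun 'I_N -> R})
    (beta : R) (p p' : {ffun 'I_N -> R}) :
  (2 <= K)%N -> (forall n, 0 < gamma n) -> 0 < beta -> beta < 1 ->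
  symmetric_best_reply K gamma beta p ->
  symmetric_best_reply K gamma beta p' -> p = p'.
Proof.
move=> hK gamma0 b0 b1 eq_p eq_p'; apply/ffunP => n0.
(* Choose the names so that [p] has the smaller multiplier, read off at page [n0]. *)
wlog le0 : p p' eq_p eq_p' / gamma n0 * marginal_payoff K beta (p n0) <=
                             gamma n0 * marginal_payoff K beta (p' n0).
  by move=> wl; case: (leP (gamma n0 * marginal_payoff K beta (p n0))
    (gamma n0 * marginal_payoff K beta (p' n0))) => [|/ltW] /wl; [|move=> h; apply/esym]; auto.
have p0 := best_reply_gt0 K N gamma beta p hK gamma0 b0 b1 eq_p.
have p'0 := best_reply_gt0 K N gamma beta p' hK gamma0 b0 b1 eq_p'.
have le_p n : p' n <= p n.
  (* Pass from page [n] to [n0] under [p], from [p] to [p'] at [n0], then back to [n] under [p']. *)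
  apply: (marginal_payoff_le K beta) => //; rewrite -(ler_pM2l (gamma0 n)).
  apply: le_trans (best_reply_first_order _ _ _ _ _ n n0 hK gamma0 b0 b1 eq_p) _.
  exact: le_trans le0 (best_reply_first_order _ _ _ _ _ n0 n hK gamma0 b0 b1 eq_p').
(* Nonnegative differences with sum zero all vanish. *)
have /psumr_eq0P : \sum_n (p n - p' n) = 0.
  by rewrite sumrB eq_p.1.2 eq_p'.1.2 subrr.
move=> zero_diff; apply/eqP; rewrite -subr_eq0; apply/eqP.
by apply: zero_diff => // n _; rewrite subr_ge0.
Qed.

(** * Existence for [beta > 1 - 1/K] *)

Lemma page_payoff_tangent {R : realType} (K : nat) (beta x t : R) :
  (2 <= K)%N -> 1 - K%:R^-1 < beta -> beta < 1 -> 0 < x -> x <= 1 -> 0 <= t ->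
  page_payoff K beta x t <=
  page_payoff K beta x x + marginal_payoff K beta x * (t - x).
Proof.
move=> hK hb b1 x0 x1 t0; have k2 : 2 <= K%:R :> R by rewrite ler_nat.
have k0 : 0 < K%:R :> R by lra.
rewrite (page_payoff_expansion K beta x t) // gerBl.
(* As [x <= 1], this is at least [beta - (1 - beta) * (K - 1) = K * beta - (K - 1) > 0]. *)
have D0 : 0 <= beta - (1 - beta) * ((K%:R - 1) * x).
  have : (1 - beta) * ((K%:R - 1) * x) <= (1 - beta) * (K%:R - 1).
    by apply: ler_wpM2l; rewrite ?ler_piMr //; lra.
  have : K%:R - 1 < K%:R * beta.
    by move: hb; rewrite -(ltr_pM2l k0) mulrBr mulr1 divff ?gt_eqF.
  lra.
have c0 : 0 <= K%:R - 1 :> R by lra.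
apply: divr_ge0; last by rewrite addr_ge0 // mulr_ge0 // ltW.
apply: mulr_ge0; last exact: sqr_ge0.
by apply: divr_ge0; rewrite mulr_ge0 ?sqr_ge0 // ltW.
Qed.

Lemma prob_vector_le1 {R : realType} (N : nat) (p : {ffun 'I_N -> R}) n :
  prob_vector p -> p n <= 1.
Proof.
by move=> [p0 <-]; rewrite (bigD1 n) //= lerDl sumr_ge0.
Qed.

(* The multiplier [lambda] is sought between the values at which the largest
   summand is [1] and at which every summand is at most [gamma n]. *)
Lemma multiplier_exists {R : realType} (N : nat) (gamma : {ffun 'I_N -> R}) (A B : R) :
  prob_vector gamma -> (forall n, 0 < gamma n) -> 0 < A -> 0 < B ->
  exists2 lambda, (forall n, 0 < lambda - B * gamma n) &
    \sum_n A * gamma n / (lambda - B * gamma n) = 1.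
Proof.
move=> prob_gamma gamma0 A0 B0.
have [n0 _] := prob_vector_gt0 _ _ prob_gamma.
have [n1 _ maxn1] := @Order.TotalTheory.arg_maxP _ R 'I_N n0 xpredT gamma isT.
pose F l := \sum_n A * gamma n / (l - B * gamma n).
(* From the left end of the interval on, all denominators stay away from zero. *)
have pos l n : (A + B) * gamma n1 <= l -> A * gamma n1 <= l - B * gamma n.
  move=> ll; have : B * gamma n <= B * gamma n1 by rewrite ler_pM2l //; exact: maxn1.
  by lra.
have pos0 l n : (A + B) * gamma n1 <= l -> 0 < l - B * gamma n.
  by move=> ll; apply: lt_le_trans (pos _ n ll); rewrite mulr_gt0.
have le_ab : (A + B) * gamma n1 <= A + B.
  by rewrite ler_piMr ?prob_vector_le1 // addr_ge0 // ltW.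
have contF : {within `[(A + B) * gamma n1, A + B], continuous F}%classic.
  apply: continuous_in_subspaceT => l; rewrite inE /= in_itv /= => /andP[ll _].
  apply: cvg_big => [|n _]; first exact: add_continuous.
  apply: cvgM; first exact: cvg_cst.
  apply: cvgV; first by rewrite gt_eqF // pos0.
  by apply: cvgB; [exact: cvg_id | exact: cvg_cst].
have [] := IVT le_ab contF (v := 1).
  (* [F] is at most [1] at the right end and at least [1] at the left end. *)
  rewrite ge_min le_max; apply/andP; split; apply/orP; [right|left].
    rewrite -prob_gamma.2; apply: ler_sum => n _.
    rewrite ler_pdivrMr ?pos0 // mulrC ler_pM2l //.
    have : B * gamma n <= B by rewrite ler_piMr ?prob_vector_le1 // ltW.
    by lra.
  rewrite /F (bigD1 n1) //= -mulrBl addrK divff ?gt_eqF ?mulr_gt0 // lerDl.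
  by apply: sumr_ge0 => n _; rewrite divr_ge0 ?mulr_ge0 ?ltW ?pos0.
move=> l; rewrite in_itv /= => /andP[ll _] Fl; exists l => // n.
exact: pos0.
Qed.

Lemma best_reply_exists {R : realType} (K N : nat) (gamma : {ffun 'I_N -> R}) (beta : R) :
  (2 <= K)%N -> prob_vector gamma -> (forall n, 0 < gamma n) -> 0 < beta -> beta < 1 ->
  1 - K%:R^-1 < beta -> exists p, symmetric_best_reply K gamma beta p.
Proof.
move=> hK prob_gamma gamma0 b0 b1 hb; have k2 : 2 <= K%:R :> R by rewrite ler_nat.
have A0 : 0 < beta * (K%:R - 1) by rewrite mulr_gt0 //; lra.
have B0 : 0 < (1 - beta) * (2 * K%:R - 1) by rewrite mulr_gt0 //; lra.
have [l l0 sum1] := multiplier_exists N gamma _ _ prob_gamma gamma0 A0 B0.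
(* The solution of [gamma n * marginal_payoff K beta (p n) = l / K ^ 2]. *)
pose p : {ffun 'I_N -> R} := [ffun n => beta * (K%:R - 1) * gamma n /
  (l - (1 - beta) * (2 * K%:R - 1) * gamma n)].
have p0 n : 0 < p n by rewrite ffunE divr_gt0 ?mulr_gt0 //; lra.
have prob_p : prob_vector p.
  split=> [n|]; first exact: ltW.
  by rewrite -sum1; apply: eq_bigr => n _; rewrite ffunE.
have FOC n : gamma n * marginal_payoff K beta (p n) = l / K%:R ^+ 2.
  have gn := gamma0 n; have ln := l0 n.
  rewrite /marginal_payoff ffunE; field.
  by rewrite !gt_eqF //; lra.
exists p; split=> // t prob_t.
(* Sum the tangent bounds: the slopes agree on all pages, so the linear terms cancel because [t] and
   [p] both have sum one. *)
apply: (@le_trans _ _ (\sum_n (gamma n * page_payoff K beta (p n) (p n)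
    + l / K%:R ^+ 2 * (t n - p n)))).
  apply: ler_sum => n _; rewrite -(FOC n) -mulrA -mulrDr ler_pM2l //.
  apply: page_payoff_tangent => //; last exact: prob_t.1.
  exact: prob_vector_le1.
by rewrite big_split /= -mulr_sumr sumrB prob_t.2 prob_p.2 subrr mulr0 addr0.
Qed.

Theorem theorem5p1 (R : realType) (K N : nat) (hK : (2 <= K)%N)
    (gamma : {ffun 'I_N -> R}) (hgamma : prob_vector gamma)
    (gamma_gt0 : forall n : 'I_N, 0 < gamma n)
    (beta : R) (beta_gt0 : 0 < beta) (beta_lt1 : beta < 1) :
  (forall s s' : {ffun 'I_K -> {ffun 'I_N -> R}},
     symmetric_equilibrium (@proportional R K) gamma beta s ->
     symmetric_equilibrium (@proportional R K) gamma beta s' ->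
     s = s') /\
  (1 - K%:R^-1 < beta ->
   exists s : {ffun 'I_K -> {ffun 'I_N -> R}},
     symmetric_equilibrium (@proportional R K) gamma beta s).
Proof.
split=> [s s' eq_s eq_s' | hb].
  (* A symmetric profile is constant, with the strategy of any one engine as its value. *)
  have i : 'I_K := Ordinal (ltnW hK).
  have sE : s = [ffun=> s i] by apply/ffunP => j; rewrite ffunE; exact: eq_s.2.
  have s'E : s' = [ffun=> s' i] by apply/ffunP => j; rewrite ffunE; exact: eq_s'.2.
  move: eq_s eq_s'; rewrite sE s'E !symmetric_equilibriumE // => eq_s eq_s'.
  by rewrite (best_reply_unique _ _ _ _ _ _ hK gamma_gt0 beta_gt0 beta_lt1 eq_s eq_s').
have [p eq_p] := best_reply_exists K N gamma beta hK hgamma gamma_gt0 beta_gt0 beta_lt1 hb.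
by exists [ffun=> p]; apply/symmetric_equilibriumE.
Qed.
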